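(* For any $\lambda>0$, there are connected $\lambda$-vertical curves $E,E'\subset\mathbb{H}$ with $\dim_H(E)<2<\dim_H(E')$.
   Context: $\mathbb{H}$ is the first Heisenberg group, identified with $\mathbb{R}^3$ with the group law $(x,y,z)(x',y',z')=\left(x+x',y+y',z+z'+\tfrac12(xy'-x'y)\right)$. The Kor\'anyi norm is $|(x,y,z)|_{\mathrm{Kor}}=\sqrt[4]{(x^2+y^2)^2+16z^2}$ and the distance is $d(a,b)=|b^{-1}a|_{\mathrm{Kor}}$. $\dim_H$ denotes Hausdorff dimension with respect to $d$. For $\lambda>0$, $\mathrm{VCone}_\lambda=\{(x,y,z)\in\mathbb{H}: |z|\ge\lambda(x^2+y^2)\}$. A set $E\subset\mathbb{H}$ is a $\lambda$-vertical curve if $E\subset p\,\mathrm{VCone}_\lambda$ for all $p\in E$. *)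

(* Defs.v *)
From HB Require Import structures.
From mathcomp Require Import all_boot all_order all_algebra.
From mathcomp Require Import all_classical all_reals all_analysis.
From mathcomp Require Import ring.

Set Implicit Arguments.
Unset Strict Implicit.
Unset Printing Implicit Defensive.

Import Order.TTheory GRing.Theory Num.Theory.
Import numFieldNormedType.Exports.

Local Open Scope classical_set_scope.
Local Open Scope ring_scope.

(* ((x, y), z), so that the library's product topology is the usual topology
   of R^3, which is also the topology induced by the Koranyi distance. *)
Notation heis R := (R * R * R)%type.

Section Heisenberg.
Variable R : realType.
Implicit Types p q a b : heis R.

Definition heis_mul p q : heis R :=
  let: (x, y, z) := p in
  let: (x', y', z') := q in
  (x + x', y + y', z + z' + 2^-1 * (x * y' - x' * y)).

Definition heis_one : heis R := (0, 0, 0).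

Definition heis_inv p : heis R := let: (x, y, z) := p in (- x, - y, - z).

Lemma heis_mulA p q a :
  heis_mul p (heis_mul q a) = heis_mul (heis_mul p q) a.
Proof.
case: p q a => [[x y] z] [[x' y'] z'] [[x2 y2] z2] /=.
by congr (_, _, _); ring.
Qed.

Lemma heis_mul1 p : heis_mul heis_one p = p.
Proof. by case: p => [[x y] z] /=; congr (_, _, _); ring. Qed.

Lemma heis_mulV p : heis_mul (heis_inv p) p = heis_one.
Proof. by case: p => [[x y] z] /=; congr (_, _, _); ring. Qed.

Definition koranyi p : R :=
  let: (x, y, z) := p in
  ((x ^+ 2 + y ^+ 2) ^+ 2 + 16 * z ^+ 2) `^ 4^-1.

Definition heis_dist a b : R := koranyi (heis_mul (heis_inv b) a).

Definition VCone (lambda : R) : set (heis R) :=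
  [set p | let: (x, y, z) := p in lambda * (x ^+ 2 + y ^+ 2) <= `|z|].

Definition vertical_curve (lambda : R) (E : set (heis R)) : Prop :=
  forall p, E p -> E `<=` heis_mul p @` VCone lambda.

End Heisenberg.

Section Hausdorff.
Local Open Scope ereal_scope.
Variables (R : realType) (T : Type) (d : T -> T -> R).

(* Extended-real valued, so that unbounded sets have diameter +oo; the
   diameter of the empty set is -oo. *)
Definition diam (U : set T) : \bar R :=
  ereal_sup [set (d p.1 p.2)%:E | p in U `*` U].

(* diam(U)^s, with diam(set0)^s = 0 for every s, including s = 0; for a
   nonempty U, diam(U)^0 = 1. *)
Definition hausdorff_gauge (s : R) (U : set T) : \bar R :=
  if `[< U = set0 >] then 0 else diam U `^ s.

Definition hausdorff_premeasure (s delta : R) (A : set T) : \bar R :=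
  ereal_inf [set \sum_(0 <= i <oo) hausdorff_gauge s (U i) | U in
    [set U : (set T)^nat | A `<=` \bigcup_i U i /\
                           forall i, diam (U i) <= delta%:E]].

(* The premeasure increases as delta decreases, so its limit as delta goes to
   0 from the right is a supremum. *)
Definition hausdorff_measure (s : R) (A : set T) : \bar R :=
  ereal_sup [set hausdorff_premeasure s delta A | delta in
    [set delta : R | (0 < delta)%R]].

Definition hausdorff_dim (A : set T) : \bar R :=
  ereal_inf [set s%:E | s in
    [set s : R | (0 <= s)%R /\ hausdorff_measure s A = 0]].

End Hausdorff.

(* Main.v *)
Require Import Defs.
From HB Require Import structures.
From mathcomp Require Import all_boot all_order all_algebra.
From mathcomp Require Import all_classical all_reals all_analysis.
From mathcomp Require Import ring lra zify.

Set Implicit Arguments.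
Unset Strict Implicit.
Unset Printing Implicit Defensive.

Import Order.TTheory GRing.Theory Num.Theory.
Import numFieldNormedType.Exports.
Local Open Scope classical_set_scope.
Local Open Scope ring_scope.

(** Both curves are lifts of a Levy curve. Put w = 1/2 + iy and q = |w|^2, and
    let a spiral similarity act on (v, z), v a complex number, by
    (w v, q z); it is an automorphism of the Heisenberg group that multiplies
    the distance by sqrt q. For A = (1, 0, H), the image of A under the spiral
    of w times its image under the spiral of the conjugate of w has horizontal
    part w + conj w = 1 and height 2qH - y/2, where -y/2 is the signed area of
    the triangle spanned by the two sides. If this height equals H, then A is
    cut into two smaller rotated copies of itself, and iterating the
    subdivision gives a curve g from 0 to A which consists of two copies of
    itself scaled by sqrt q. Its dimension is therefore 2 ln 2 / ln (1/q): less
    than 2 for q < 1/2 and greater than 2 for q > 1/2. Both signs occur: the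
    equation for the height says H = y / (4q - 2), with 4q - 2 = 4y^2 - 1, so y
    slightly above 1/2 gives q > 1/2, y slightly above -1/2 gives q < 1/2, and
    in both cases H is as large as one likes ([curve_parameters]).

    A large H makes the curve vertical. The horizontal part of g stays bounded
    independently of H, while on [1/2, 1] its height is at least of order qH;
    by self-similarity the height of g(t) dominates K times its squared
    horizontal norm for all t ([height_ge_planar]). An increment
    g(s)^-1 g(t) is, up to a similarity, an increment for which s <= 1/2 <= t
    ([increment_cases]), hence a product of an increment that ends at g(1/2)
    and one that starts there. The second is a similar copy of an initial
    increment of g, the first one of an initial increment of the reversed
    curve, which satisfies the same subdivision equation
    ([reversal_refinable]). The area term in a product is bounded by the
    squared horizontal norms, so it is absorbed by the heights, and the product
    is again in the cone ([mul_vertical]). The same decomposition shows that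
    for t - s of order 2^-k the increment has size sqrt q ^ k, from above
    ([increment_upper]) and from below ([increment_lower]).

    The upper bound makes g continuous and bounds the dimension by covering the
    curve by its 2^k pieces of generation k. The lower bound says that the
    inverse of g is Hoelder with exponent 2 ln 2 / ln (1/q), so a cover of the
    curve with small Hausdorff sum would give a cover of [0, 1] by intervals of
    small total length ([hausdorff_dim_ge]). *)

(** * Squares, geometric sequences and dyadic scales *)

Section RealLine.
Variable R : realType.

Lemma sum_sqr_eq0 (a b : R) : a ^+ 2 + b ^+ 2 == 0 -> a = 0 /\ b = 0.
Proof.
by rewrite paddr_eq0 ?sqr_ge0// !sqrf_eq0 => /andP[/eqP -> /eqP ->].
Qed.

Lemma norm_le_sqr (a b : R) : 0 <= b -> a ^+ 2 <= b ^+ 2 -> `|a| <= b.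
Proof.
by move=> b0 ab; rewrite -(@ler_pXn2r _ 2)// ?nnegrE// real_normK ?num_real.
Qed.

Lemma half_cases (t : R) : 0 <= t <= 1 ->
  (0 <= t <= 2^-1) /\ (0 <= 2 * t <= 1) \/
  (2^-1 <= t <= 1) /\ (0 <= 2 * t - 1 <= 1).
Proof.
move=> /andP[t0 t1]; case: (lerP t 2^-1) => ht; [left|right];
  by split; apply/andP; split; lra.
Qed.

Lemma exists_dyadic_le (t : R) : 0 < t -> exists k, 2^-1 ^+ k <= t.
Proof.
move=> t0; have : (2^-1 : R) ^+ k @[k --> \oo] --> (0 : R).
  by apply: cvg_expr; rewrite ger0_norm ?invr_ge0//; lra.
move=> /cvgrPdist_le/(_ _ t0)[k _ /(_ k)/=]; rewrite leqnn sub0r normrN => /(_ isT).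
by rewrite ger0_norm ?exprn_ge0 ?invr_ge0// => kt; exists k.
Qed.

Lemma dyadic_cell k (t : R) : 0 <= t <= 1 -> exists2 i, (i < 2 ^ k)%N &
  i%:R * 2^-1 ^+ k <= t <= i.+1%:R * 2^-1 ^+ k.
Proof.
move=> t01; elim: k => [|k [i ik /andP[it ti]]].
  by exists 0%N; rewrite // expr0 !mulr1.
have [tm|mt] := lerP t ((2 * i + 1)%:R * 2^-1 ^+ k.+1).
  exists (2 * i)%N; first by rewrite expnS; lia.
  rewrite -[(2 * i).+1]addn1 tm andbT; move: it; rewrite exprS natrM; lra.
exists (2 * i + 1)%N; first by rewrite expnS; lia.
rewrite (ltW mt)/=; move: ti; rewrite exprS -[in X in _ -> X]natr1 natrD natrM -natr1.
lra.
Qed.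

Lemma geometric_cvg0 (B r : R) : 0 <= r < 1 -> B * r ^+ k @[k --> \oo] --> 0.
Proof.
move=> /andP[r0 r1]; rewrite -[X in _ --> X](mulr0 B).
by apply: cvgM; [exact: cvg_cst|apply: cvg_expr; rewrite ger0_norm].
Qed.

(** The increments form an absolutely convergent series. *)
Lemma is_cvg_geometric_increments (r C : R) (u : nat -> R) :
  0 <= r < 1 -> (forall k, `|u k.+1 - u k| <= C * r ^+ k) -> cvgn u.
Proof.
move=> /andP[r0 r1] uC.
have : cvgn (series (telescope u)).
  apply: normed_cvg; apply: (@series_le_cvg _ _ (geometric C r)) => //.
  - by move=> n; exact: normr_ge0.
  - by move=> n; exact: (le_trans (normr_ge0 _) (uC n)).
  - by apply: is_cvg_geometric_series; rewrite ger0_norm.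
rewrite telescopeK => cv.
have -> : u = (fun n => u n - u 0%N) \+ cst (u 0%N).
  by apply/funext => n /=; rewrite subrK.
by apply: is_cvgD => //; exact: is_cvg_cst.
Qed.

End RealLine.

(** * Heisenberg increments and spiral similarities *)

Section Algebra.
Variable R : realType.
Implicit Types (p q : heis R) (a b : R).

Definition planar p : R := p.1.1 ^+ 2 + p.1.2 ^+ 2.

(** The distance between p and q is the Koranyi norm of this element, and left
    translations do not change it. *)
Definition increment p q : heis R := heis_mul (heis_inv p) q.

(** The horizontal plane is multiplied by the complex number a + ib; the height
    scales like an area, which makes this a group automorphism. *)
Definition spiral a b p : heis R :=
  let: (x, y, z) := p in (a * x - b * y, b * x + a * y, (a ^+ 2 + b ^+ 2) * z).

(** Reflecting the plane changes the sign of the area term. Keeping the sign of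
    the height then reverses the order of products; this is what makes it
    possible to read a curve backwards with heights still positive. *)
Definition mirror p : heis R := let: (x, y, z) := p in (x, - y, z).

Ltac heis_ring := rewrite /increment /planar /=; try congr (_, _, _); try ring.

Lemma planar_ge0 p : 0 <= planar p.
Proof. by rewrite addr_ge0 ?sqr_ge0. Qed.

Lemma planar_spiral a b p : planar (spiral a b p) = (a ^+ 2 + b ^+ 2) * planar p.
Proof. case: p => [[x y] z]; heis_ring. Qed.

Lemma height_spiral a b p : (spiral a b p).2 = (a ^+ 2 + b ^+ 2) * p.2.
Proof. by case: p => [[x y] z]. Qed.

Lemma planar_mirror p : planar (mirror p) = planar p.
Proof. case: p => [[x y] z]; heis_ring. Qed.

Lemma height_mirror p : (mirror p).2 = p.2.
Proof. by case: p => [[x y] z]. Qed.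

Lemma mirrorK : involutive mirror.
Proof. by move=> [[x y] z]; rewrite /= opprK. Qed.

Lemma mirror_mul p q : mirror (heis_mul p q) = heis_mul (mirror q) (mirror p).
Proof. case: p q => [[x y] z] [[x' y'] z']; heis_ring. Qed.

Lemma mirror_spiral a b p : mirror (spiral a b p) = spiral a (- b) (mirror p).
Proof. case: p => [[x y] z]; heis_ring. Qed.

Lemma spiral_mul a b p q :
  spiral a b (heis_mul p q) = heis_mul (spiral a b p) (spiral a b q).
Proof. case: p q => [[x y] z] [[x' y'] z']; heis_ring. Qed.

Lemma spiral_inv a b p : spiral a b (heis_inv p) = heis_inv (spiral a b p).
Proof. case: p => [[x y] z]; heis_ring. Qed.

Lemma spiral_increment a b p q :
  spiral a b (increment p q) = increment (spiral a b p) (spiral a b q).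
Proof. by rewrite spiral_mul spiral_inv. Qed.

Lemma increment1 p : increment (heis_one R) p = p.
Proof. case: p => [[x y] z]; heis_ring. Qed.

Lemma increment_self p : increment p p = heis_one R.
Proof. exact: heis_mulV. Qed.

Lemma mul_increment p q : heis_mul p (increment p q) = q.
Proof. case: p q => [[x y] z] [[x' y'] z']; heis_ring. Qed.

Lemma increment_mul2l m p q :
  increment (heis_mul m p) (heis_mul m q) = increment p q.
Proof. case: m p q => [[x y] z] [[x' y'] z'] [[a b] c]; heis_ring. Qed.

Lemma increment_mulr p m q :
  increment p (heis_mul m q) = heis_mul (increment p m) q.
Proof. case: m p q => [[x y] z] [[x' y'] z'] [[a b] c]; heis_ring. Qed.

Lemma incrementC p q : increment q p = heis_inv (increment p q).
Proof. case: p q => [[x y] z] [[x' y'] z']; heis_ring. Qed.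

Lemma height_mul p q : (heis_mul p q).2 =
  p.2 + q.2 + 2^-1 * (p.1.1 * q.1.2 - q.1.1 * p.1.2).
Proof. by case: p q => [[x y] z] [[x' y'] z']. Qed.

Lemma planar_mul_le p q : planar (heis_mul p q) <= 2 * (planar p + planar q).
Proof.
case: p q => [[x y] z] [[x' y'] z']; rewrite /planar/=.
have := sqr_ge0 (x - x'); have := sqr_ge0 (y - y'); nra.
Qed.

(** The area of the triangle spanned by the horizontal parts, by the
    arithmetic-geometric mean inequality. *)
Lemma area_le p q :
  `|2^-1 * (p.1.1 * q.1.2 - q.1.1 * p.1.2)| <= 4^-1 * (planar p + planar q).
Proof.
case: p q => [[x y] z] [[x' y'] z']; rewrite /planar/= ler_norml.
have := sqr_ge0 (x - y'); have := sqr_ge0 (x + y').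
have := sqr_ge0 (y - x'); have := sqr_ge0 (y + x'); nra.
Qed.

Lemma planar_increment_le (p p' : heis R) : planar (increment p p') <= 2 * (planar p + planar p').
Proof.
apply: le_trans (planar_mul_le _ _) _.
by case: p => [[a b] c]; rewrite /planar/= !sqrrN.
Qed.

Lemma height_increment_le (p p' : heis R) : `|(increment p p').2| <=
  `|p.2| + `|p'.2| + (planar p + planar p').
Proof.
rewrite /increment height_mul (le_trans (ler_normD _ _))// lerD//.
  by rewrite (le_trans (ler_normD _ _))//; case: p => [[a b] c] /=; rewrite normrN.
apply: le_trans (area_le _ _) _.
have := planar_ge0 p; have := planar_ge0 p'.
have -> : planar (heis_inv p) = planar p.
  by case: p => [[a b] c]; rewrite /planar/= !sqrrN.
lra.
Qed.

End Algebra.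

(** * The subdivision equation *)

(** The hypotheses are q = |1/2 + iy|^2 and the equation 2qH - y/2 = H for the
    height, both cleared of denominators, and bounds that keep q near 1/2, so
    that in particular sqrt q is at most 3/4. *)
Section Curve.
Variables (R : realType) (y H q : R).
Hypothesis fourqE : 1 + 4 * y ^+ 2 = 4 * q.
Hypothesis heightE : 4 * q * H - y = 2 * H.
Hypotheses (q_ge : 7 <= 16 * q) (q_le : 16 * q <= 9).

Definition apex : heis R := (1, 0, H).
(** The similarities that map the segment from the origin to the apex onto its
    first and second half; they stand for w = 1/2 + iy and its conjugate. *)
Definition lower_half (p : heis R) : heis R := spiral 2^-1 y p.
Definition upper_half (p : heis R) : heis R :=
  heis_mul (lower_half apex) (spiral 2^-1 (- y) p).

(** A bounded parametrization by [0, 1] of the attractor of the two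
    similarities. The two clauses overlap at t = 1/2, where they express that
    the copies meet. The bound on the horizontal part is explicit because it
    must not depend on H, whereas any bound on the height will do. *)
Definition refinable (B : R) (g : R -> heis R) : Prop :=
  [/\ forall t, 0 <= t <= 2^-1 -> g t = lower_half (g (2 * t)),
      forall t, 2^-1 <= t <= 1 -> g t = upper_half (g (2 * t - 1)),
      forall t, 0 <= t <= 1 -> planar (g t) <= B &
      exists M, forall t, 0 <= t <= 1 -> `|(g t).2| <= M].

Lemma q_gt0 : 0 < q. Proof. by move: q_ge; lra. Qed.
Lemma q_lt1 : q < 1. Proof. by move: q_le; lra. Qed.

Lemma qE : 2^-1 ^+ 2 + y ^+ 2 = q.
Proof.
apply: (mulfI (_ : 4 != 0)); first by rewrite pnatr_eq0.
by rewrite -fourqE; field.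
Qed.

Lemma planar_lower p : planar (lower_half p) = q * planar p.
Proof. by rewrite planar_spiral qE. Qed.
Lemma height_lower p : (lower_half p).2 = q * p.2.
Proof. by rewrite height_spiral qE. Qed.
Lemma planar_spiralN p : planar (spiral 2^-1 (- y) p) = q * planar p.
Proof. by rewrite planar_spiral sqrrN qE. Qed.
Lemma height_spiralN p : (spiral 2^-1 (- y) p).2 = q * p.2.
Proof. by rewrite height_spiral sqrrN qE. Qed.

(** The height equation is exactly what closes the subdivision. *)
Lemma upper_apex : upper_half apex = apex.
Proof.
rewrite /upper_half/lower_half/=; congr (_, _, _); [by field|by field|].
by move: heightE; rewrite sqrrN qE; lra.
Qed.

Lemma upper_one : upper_half (heis_one R) = lower_half apex.
Proof. by rewrite /upper_half/lower_half/=; congr (_, _, _); field. Qed.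

Lemma height_upper p : (upper_half p).2 =
  q * H + q * p.2 + 2^-1 * ((lower_half apex).1.1 * (spiral 2^-1 (- y) p).1.2 -
     (spiral 2^-1 (- y) p).1.1 * (lower_half apex).1.2).
Proof. by rewrite /upper_half height_mul height_lower height_spiralN. Qed.

Lemma planar_apex : planar apex = 1.
Proof. by rewrite /planar/=; ring. Qed.

(** The area term is at most (q + 22 q) / 4, which is less than 4. *)
Lemma height_upper_ge p : planar p <= 22 -> q * H + q * p.2 - 4 <= (upper_half p).2.
Proof.
move=> pB; rewrite height_upper.
have := area_le (lower_half apex) (spiral 2^-1 (- y) p).
rewrite planar_lower planar_spiralN planar_apex ler_norml.
have := planar_ge0 p; have := q_ge; have := q_le; nra.
Qed.

Lemma q_neq1 : 1 - q != 0.
Proof. by rewrite gt_eqF// subr_gt0 q_lt1. Qed.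

(** The upper half contracts distances to the apex, which it fixes: first the
    horizontal part by the factor q of squared norms, and then the height. *)
Lemma apex_fixed p : p = upper_half p -> p = apex.
Proof.
case: p => [[x x'] z]; rewrite /upper_half/lower_half/= => -[xE x'E zE].
have : (1 - q) * ((x - 1) ^+ 2 + x' ^+ 2) = 0.
  have : (2^-1 * (x - 1) + y * x') ^+ 2 + (2^-1 * x' - y * (x - 1)) ^+ 2 =
      q * ((x - 1) ^+ 2 + x' ^+ 2) by rewrite -qE; ring.
  have -> : 2^-1 * (x - 1) + y * x' = x - 1 by lra.
  have -> : 2^-1 * x' - y * (x - 1) = x' by lra.
  by rewrite mulrBl mul1r => <-; rewrite subrr.
move/eqP; rewrite mulf_eq0 (negPf q_neq1)/= => /sum_sqr_eq0[/eqP].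
rewrite subr_eq0 => /eqP x1 x'0.
rewrite x1 x'0; congr (_, _, _).
have /eqP : (1 - q) * (z - H) = 0.
  by move: zE heightE; rewrite sqrrN qE x1 x'0; lra.
by rewrite mulf_eq0 (negPf q_neq1)/= subr_eq0 => /eqP.
Qed.

Lemma one_fixed p : p = lower_half p -> p = heis_one R.
Proof.
move=> pE; have := planar_lower p; have := height_lower p; rewrite -pE.
case: p {pE} => [[x x'] z]; rewrite /planar/= => zE NE.
have /eqP : (1 - q) * z = 0 by lra.
rewrite mulf_eq0 (negPf q_neq1)/= => /eqP ->.
have /eqP : (1 - q) * (x ^+ 2 + x' ^+ 2) = 0 by lra.
by rewrite mulf_eq0 (negPf q_neq1)/= => /sum_sqr_eq0[-> ->].
Qed.

Lemma refinable0 B g : refinable B g -> g 0 = heis_one R.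
Proof.
case=> gL _ _ _; apply: one_fixed; rewrite [LHS]gL ?mulr0//.
by rewrite lexx invr_ge0 ler0n.
Qed.

Lemma refinable1 B g : refinable B g -> g 1 = apex.
Proof.
case=> _ gU _ _; apply: apex_fixed; rewrite [LHS]gU.
  by congr (upper_half (g _)); ring.
by rewrite lexx andbT; lra.
Qed.

Lemma refinable_weaken B B' g : B <= B' -> refinable B g -> refinable B' g.
Proof.
by move=> BB' [gL gU gB gM]; split=> // t t01; apply: le_trans BB'; exact: gB.
Qed.

(** The increment from g(1 - t) to the end of the curve, as an initial piece of
    the curve run backwards; the mirror restores the order of factors. *)
Definition reversal (g : R -> heis R) (t : R) : heis R :=
  mirror (increment (g (1 - t)) apex).

Lemma reversalE g t : increment (g t) apex = mirror (reversal g (1 - t)).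
Proof. by rewrite /reversal mirrorK; congr (increment (g _) _); ring. Qed.

(** Mirroring exchanges w with its conjugate, and running backwards exchanges
    the two halves, so together they leave the subdivision equation as it is.
    The constant 22 is 2 * (10 + 1). *)
Lemma reversal_refinable g : refinable 10 g -> refinable 22 (reversal g).
Proof.
move=> gr; case: (gr) => gL gU gB [M gM]; split.
- move=> t /andP[t0 t1]; rewrite /reversal.
  rewrite gU; last by apply/andP; split; lra.
  rewrite -{1}upper_apex /upper_half increment_mul2l -spiral_increment.
  rewrite mirror_spiral opprK /lower_half; congr (spiral _ _ (mirror (increment (g _) _))).
  ring.
- move=> t /andP[t0 t1]; rewrite /reversal.
  rewrite gL; last by apply/andP; split; lra.
  rewrite -{1}upper_apex /upper_half increment_mulr /lower_half -spiral_increment.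
  rewrite mirror_mul !mirror_spiral opprK; congr (heis_mul _ _).
    by rewrite /= oppr0.
  by congr (spiral _ _ (mirror (increment (g _) _))); ring.
- move=> t /andP[t0 t1]; rewrite planar_mirror.
  apply: le_trans (planar_increment_le _ _) _; rewrite planar_apex.
  have : planar (g (1 - t)) <= 10 by apply: gB; apply/andP; split; lra.
  lra.
- exists (M + `|H| + 11) => t /andP[t0 t1]; rewrite height_mirror.
  apply: le_trans (height_increment_le _ _) _; rewrite planar_apex /=.
  have t'01 : 0 <= 1 - t <= 1 by apply/andP; split; lra.
  have := gB _ t'01; have := gM _ t'01; lra.
Qed.

(** * Increments from the starting point *)

(** All estimates go up in scale: a point of the first half is an image under
    the lower similarity, and only the second half needs an argument, where the
    height is large. *)
Section OneSided.
Variables (K : R) (g : R -> heis R).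
Hypothesis K_ge1 : 1 <= K.
Hypothesis H_large : 22 * K + 4 <= q * H.
Hypothesis g_refinable : refinable 22 g.

Lemma q_exp_ge0 k : 0 <= q ^+ k.
Proof. by rewrite exprn_ge0 ?ltW ?q_gt0. Qed.

(** An a priori lower bound that improves by the factor q at each subdivision
    is a lower bound by 0. *)
Lemma ge0_geometric (a M : R) : (forall k, - (q ^+ k * M) <= a) -> 0 <= a.
Proof.
move=> aM; rewrite leNgt; apply/negP => a0.
have cv : (fun k => q ^+ k * M) @ \oo --> (0 : R).
  rewrite -[X in _ --> X](mul0r M); apply: cvgM; last exact: cvg_cst.
  by apply: cvg_expr; rewrite ger0_norm ?q_lt1// ltW// q_gt0.
have /cvgrPdist_lt/(_ (- a)) := cv; rewrite oppr_gt0 => /(_ a0)[k _ /(_ k)/=].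
rewrite leqnn sub0r normrN => /(_ isT); rewrite ltr_norml => /andP[_].
have := aM k; lra.
Qed.

Lemma height_ge0 t : 0 <= t <= 1 -> 0 <= (g t).2.
Proof.
case: g_refinable => gL gU gB [M gM] t01.
apply: (@ge0_geometric _ M) => k; elim: k t t01 => [|k IH] t t01.
  by have := gM _ t01; rewrite expr0 mul1r ler_norml => /andP[].
case: (half_cases t01) => -[th t'01]; have := IH _ t'01; have := gB _ t'01.
  rewrite (gL t)// height_lower exprS => _; have := q_gt0; nra.
rewrite (gU t)// => /height_upper_ge; have := q_gt0.
have := H_large; have := K_ge1; rewrite exprS; nra.
Qed.

Lemma height_ge t : 2^-1 <= t <= 1 -> 22 * K <= (g t).2.
Proof.
case: g_refinable => gL gU gB _ th; rewrite (gU t)//.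
have t'01 : 0 <= 2 * t - 1 <= 1 by move: th => /andP[? ?]; apply/andP; split; lra.
have := height_upper_ge (gB _ t'01); have := height_ge0 t'01.
have := H_large; have := q_gt0; nra.
Qed.

(** In the second half the height is at least 22 K and the squared horizontal
    norm at most 22; the inequality is invariant under the lower similarity. *)
Lemma height_ge_planar t : 0 <= t <= 1 -> K * planar (g t) <= (g t).2.
Proof.
case: (g_refinable) => gL gU gB _ t01; rewrite -subr_ge0.
apply: (@ge0_geometric _ (22 * K)) => k; elim: k t t01 => [|k IH] t t01.
  have := height_ge0 t01; have := gB _ t01; have := K_ge1; rewrite expr0; nra.
case: (half_cases t01) => -[th t'01].
  have := IH _ t'01; rewrite (gL t)// height_lower planar_lower exprS.
  have := q_gt0; nra.
have := height_ge th; have := gB _ t01; have := q_exp_ge0 k.+1.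
have := K_ge1; nra.
Qed.

Lemma height_growth k t : 2^-1 ^+ k <= t <= 1 -> q ^+ k <= (g t).2.
Proof.
case: (g_refinable) => gL gU gB _; elim: k t => [|k IH] t.
  rewrite !expr0 => t1; have := @height_ge t; move: t1 => /andP[t0 t1].
  have -> : 2^-1 <= t <= 1 by apply/andP; split; lra.
  by move=> /(_ isT); have := K_ge1; lra.
rewrite exprS => /andP[t0 t1].
have : 0 <= t <= 1.
  by rewrite t1 andbT (le_trans _ t0)// mulr_ge0// ?exprn_ge0// invr_ge0.
move=> /half_cases[] [th /andP[t'0 t'1]].
  have : 2^-1 ^+ k <= 2 * t <= 1 by apply/andP; split=> //; lra.
  move=> /IH; rewrite (gL t)// height_lower exprS; have := q_gt0; nra.
have := height_ge th; have : q ^+ k.+1 <= 1.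
  by rewrite exprn_ile1 ?ltW ?q_gt0 ?q_lt1.
by have := K_ge1; lra.
Qed.

Lemma one_sided_upper : exists2 M, 0 <= M & forall k t, 0 <= t <= 2^-1 ^+ k ->
  planar (g t) <= M * q ^+ k /\ `|(g t).2| <= M * q ^+ k.
Proof.
case: (g_refinable) => gL gU gB [M gM].
exists (Num.max 22 M); first by rewrite le_max; apply/orP; left.
move=> k; elim: k => [|k IH] t; rewrite ?expr0.
  move=> t01; rewrite !mulr1 !le_max; split; apply/orP; [left|right].
    exact: gB.
  exact: gM.
have k1 : 2^-1 ^+ k <= 1 :> R by rewrite exprn_ile1// ?invr_ge0//; lra.
rewrite exprS; move: IH k1; set e := 2^-1 ^+ k => IH k1 /andP[t0 t1].
have /IH[] : 0 <= 2 * t <= e by apply/andP; split; lra.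
rewrite (gL t); last by apply/andP; split; lra.
rewrite height_lower planar_lower normrM (ger0_norm (ltW q_gt0)) exprS.
have := q_gt0; set m := Num.max _ _; set e' := q ^+ k.
by move=> q0 h1 h2; split; nra.
Qed.

End OneSided.

(** * Existence of the curve *)

Definition horizontal_sqdist (p p' : heis R) : R :=
  (p.1.1 - p'.1.1) ^+ 2 + (p.1.2 - p'.1.2) ^+ 2.

(** Iterates of the subdivision operator on the constant curve at the origin. *)
Fixpoint approx (k : nat) (t : R) : heis R :=
  if k is k'.+1 then
    if t <= 2^-1 then lower_half (approx k' (2 * t))
    else upper_half (approx k' (2 * t - 1))
  else heis_one R.

Lemma approxS k t : approx k.+1 t =
  if t <= 2^-1 then lower_half (approx k (2 * t))
  else upper_half (approx k (2 * t - 1)).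
Proof. by []. Qed.

(** The bound 10 is invariant because |v + v'|^2 <= 5 |v|^2 + (5/4) |v'|^2, and
    5 q + (5/4) 10 q <= 10 for q <= 9/16. *)
Lemma planar_upper_le p : planar p <= 10 -> planar (upper_half p) <= 10.
Proof.
move=> p10.
have : planar (upper_half p) <=
    5 * planar (lower_half apex) + 5 / 4 * planar (spiral 2^-1 (- y) p).
  rewrite /upper_half; move: (lower_half _) (spiral _ _ _).
  move=> [[a b] c] [[a' b'] c']; rewrite /planar/=.
  by have := sqr_ge0 (2 * a - 2^-1 * a'); have := sqr_ge0 (2 * b - 2^-1 * b'); nra.
rewrite planar_lower planar_spiralN planar_apex.
by have := planar_ge0 p; have := q_ge; have := q_le; nra.
Qed.

Lemma planar_approx k t : planar (approx k t) <= 10.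
Proof.
elim: k t => [|k IH] t /=; first by rewrite /planar/=; lra.
case: ifP => _; last exact: planar_upper_le.
rewrite planar_lower; have := IH (2 * t).
by have := planar_ge0 (approx k (2 * t)); have := q_ge; have := q_le; nra.
Qed.

Lemma height_approx_le k t : `|(approx k t).2| <= 4 * (`|H| + 2).
Proof.
elim: k t => [|k IH] t.
  by rewrite /= normr0; have := normr_ge0 H; lra.
rewrite approxS; case: ifP => _.
  rewrite height_lower normrM (ger0_norm (ltW q_gt0)).
  have := IH (2 * t); have := normr_ge0 H; have := q_le; have := q_ge.
  by have := normr_ge0 (approx k (2 * t)).2; nra.
rewrite height_upper (le_trans (ler_normD _ _))//.
have := IH (2 * t - 1); have := planar_approx k (2 * t - 1).
have := planar_ge0 (approx k (2 * t - 1)).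
move: (approx k _) => p p0 p10 pM.
have := area_le (lower_half apex) (spiral 2^-1 (- y) p).
rewrite planar_lower planar_spiralN planar_apex.
move: (2^-1 * (_ - _)) => area al.
have := ler_normD (q * H) (q * p.2); rewrite !normrM (ger0_norm (ltW q_gt0)).
have := normr_ge0 H; have := normr_ge0 p.2; have := q_le; have := q_ge.
nra.
Qed.

Lemma sqdist_lower p p' :
  horizontal_sqdist (lower_half p) (lower_half p') = q * horizontal_sqdist p p'.
Proof.
rewrite -qE /horizontal_sqdist.
by case: p p' => [[a b] c] [[a' b'] c'] /=; ring.
Qed.

Lemma sqdist_upper p p' :
  horizontal_sqdist (upper_half p) (upper_half p') =
  q * horizontal_sqdist p p'.
Proof.
rewrite -qE /horizontal_sqdist.
by case: p p' => [[a b] c] [[a' b'] c'] /=; ring.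
Qed.

Lemma sqdist_ge0 p p' : 0 <= horizontal_sqdist p p'.
Proof. by rewrite addr_ge0 ?sqr_ge0. Qed.

(** Squared distances contract by q, and q <= (3/4)^2. *)
Lemma sqdist_approx k t :
  horizontal_sqdist (approx k.+1 t) (approx k t) <= (4 * (3 / 4) ^+ k) ^+ 2.
Proof.
elim: k t => [|k IH] t.
  have := planar_approx 1 t.
  by rewrite /planar /horizontal_sqdist/= !subr0; lra.
have step s : q * horizontal_sqdist (approx k.+1 s) (approx k s) <=
    (4 * (3 / 4) ^+ k.+1) ^+ 2.
  rewrite [_ ^+ k.+1]exprS; have := IH s; have := sqdist_ge0 (approx k.+1 s) (approx k s).
  move: (_ ^+ k) (horizontal_sqdist _ _) => e d d0 de.
  have -> : (4 * (3 / 4 * e)) ^+ 2 = 16^-1 * (9 * (4 * e) ^+ 2) by field.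
  by have := q_le; have := q_ge; nra.
by rewrite [approx k.+2 t]approxS [approx k.+1 t]approxS; case: ifP => _;
  rewrite ?sqdist_lower ?sqdist_upper; apply: step.
Qed.

(** Heights contract by q, up to an area term that is linear in the difference
    of the horizontal parts and so decays like (3/4)^k. As q < 3/4, this slower
    rate prevails; 11 is large enough for 9/16 * 11 + 2 <= 3/4 * 11. *)
Lemma height_approx k t :
  `|(approx k.+1 t).2 - (approx k t).2| <= (`|H| + 11) * (3 / 4) ^+ k.
Proof.
elim: k t => [|k IH] t.
  rewrite /= subr0 expr0 mulr1; case: ifP => _ /=.
    by rewrite mulr0 normr0; have := normr_ge0 H; lra.
  rewrite !(mulr0, subr0, addr0, mul0r) qE normrM.
  rewrite (ger0_norm (ltW q_gt0)).
  by have := q_le; have := q_ge; have := normr_ge0 H; nra.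
have e_ge0 : 0 <= (3 / 4 : R) ^+ k by rewrite exprn_ge0//; lra.
rewrite [approx k.+2 t]approxS [approx k.+1 t]approxS; case: ifP => _.
  have := IH (2 * t).
  rewrite !height_lower -mulrBr normrM (ger0_norm (ltW q_gt0)).
  rewrite exprS.
  have := q_le; have := q_ge; have := normr_ge0 H.
  move: e_ge0 (normr_ge0 ((approx k.+1 (2 * t)).2 - (approx k (2 * t)).2)).
  move: (_ ^+ k) `|_ - _| `|H| => e d h *; nra.
have := IH (2 * t - 1); have := sqdist_approx k (2 * t - 1).
rewrite [_ ^+ k.+1]exprS; move: e_ge0; move: (_ ^+ k) (approx k.+1 _) (approx k _) => e.
move=> [[a b] c] [[a' b'] c']; rewrite /horizontal_sqdist/= => e0 ab cc.
(* The change of the area term; the next identity is Lagrange's, with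
   (1/4 - y^2)^2 + y^2 = q^2. *)
set s := 2^-1 * ((4^-1 - y ^+ 2) * (b - b') - y * (a - a')).
have s2 : s ^+ 2 = 4^-1 * q ^+ 2 * ((a - a') ^+ 2 + (b - b') ^+ 2) -
    4^-1 * ((4^-1 - y ^+ 2) * (a - a') + y * (b - b')) ^+ 2.
  by rewrite -qE /s; field.
have se : `|s| <= 2 * e.
  apply: norm_le_sqr; first by lra.
  have q2 : q ^+ 2 <= 1.
    by rewrite expr_le1 ?(ltW q_gt0) ?(ltW q_lt1).
  move: s2 (sqr_ge0 ((4^-1 - y ^+ 2) * (a - a') + y * (b - b'))) ab.
  have := sqr_ge0 (a - a'); have := sqr_ge0 (b - b'); move: q2 e0.
  move: (_ + (b - b') ^+ 2) => d.
  nra.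
rewrite [X in `|X|](_ : _ = q * (c - c') + s); last first.
  by rewrite -qE /s; field.
apply: le_trans (ler_normD _ _) _.
rewrite normrM (ger0_norm (ltW q_gt0)).
have := q_le; have := q_ge; have := normr_ge0 H; move: cc se e0 (normr_ge0 (c - c')).
move: `|c - c'| `|H| `|s| => d h n; nra.
Qed.

Definition curve (t : R) : heis R :=
  (limn (fun k => (approx k t).1.1), limn (fun k => (approx k t).1.2),
   limn (fun k => (approx k t).2)).

Definition tends_to (p_ : nat -> heis R) (p : heis R) : Prop :=
  [/\ (p_ k).1.1 @[k --> \oo] --> p.1.1, (p_ k).1.2 @[k --> \oo] --> p.1.2 &
      (p_ k).2 @[k --> \oo] --> p.2].

Lemma tends_to_unique p_ p p' : tends_to p_ p -> tends_to p_ p' -> p = p'.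
Proof.
case: p p' => [[a b] c] [[a' b'] c'] [/= xa yb zc] [/= xa' yb' zc'].
by rewrite (cvg_unique _ xa xa')// (cvg_unique _ yb yb')// (cvg_unique _ zc zc').
Qed.

Lemma tends_to_shift p_ p : tends_to p_ p -> tends_to (fun k => p_ k.+1) p.
Proof.
case=> px py pz; split.
- by rewrite -cvg_shiftS in px.
- by rewrite -cvg_shiftS in py.
- by rewrite -cvg_shiftS in pz.
Qed.

Lemma tends_to_spiral a b p_ p :
  tends_to p_ p -> tends_to (fun k => spiral a b (p_ k)) (spiral a b p).
Proof.
have spiralE m : spiral a b m = (a * m.1.1 - b * m.1.2, b * m.1.1 + a * m.1.2,
  (a ^+ 2 + b ^+ 2) * m.2) by case: m => [[]].
case=> px py pz; rewrite [spiral a b p]spiralE; split => /=.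
- under eq_fun do rewrite spiralE/=.
  by apply: cvgB; apply: cvgM => //; exact: cvg_cst.
- under eq_fun do rewrite spiralE/=.
  by apply: cvgD; apply: cvgM => //; exact: cvg_cst.
- under eq_fun do rewrite spiralE/=.
  by apply: cvgM => //; exact: cvg_cst.
Qed.

Lemma tends_to_mul m p_ p :
  tends_to p_ p -> tends_to (fun k => heis_mul m (p_ k)) (heis_mul m p).
Proof.
have mulE n : heis_mul m n = (m.1.1 + n.1.1, m.1.2 + n.1.2,
    m.2 + n.2 + 2^-1 * (m.1.1 * n.1.2 - n.1.1 * m.1.2)).
  by case: m n => [[? ?] ?] [[]].
case=> px py pz; rewrite [heis_mul m p]mulE; split => /=.
- under eq_fun do rewrite mulE/=.
  by apply: cvgD => //; exact: cvg_cst.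
- under eq_fun do rewrite mulE/=.
  by apply: cvgD => //; exact: cvg_cst.
- under eq_fun do rewrite mulE/=.
  apply: cvgD; first by apply: cvgD => //; exact: cvg_cst.
  apply: cvgM; first exact: cvg_cst.
  by apply: cvgB; apply: cvgM => //; exact: cvg_cst.
Qed.

Lemma cvg_curve t : tends_to (fun k => approx k t) (curve t).
Proof.
have r01 : 0 <= (3 / 4 : R) < 1 by apply/andP; split; lra.
have e_ge0 k : 0 <= 4 * (3 / 4 : R) ^+ k by rewrite mulr_ge0// exprn_ge0//; lra.
split; apply: (is_cvg_geometric_increments r01).
- move=> k; apply: norm_le_sqr; first exact: e_ge0.
  by apply: le_trans (sqdist_approx k t); rewrite lerDl sqr_ge0.
- move=> k; apply: norm_le_sqr; first exact: e_ge0.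
  by apply: le_trans (sqdist_approx k t); rewrite lerDr sqr_ge0.
- by move=> k; exact: height_approx.
Qed.

Lemma curve_lower t : t <= 2^-1 -> curve t = lower_half (curve (2 * t)).
Proof.
move=> th; apply: tends_to_unique (tends_to_shift (cvg_curve t)) _.
under eq_fun do rewrite approxS th.
exact/tends_to_spiral/cvg_curve.
Qed.

Lemma curve_upper_lt t : 2^-1 < t -> curve t = upper_half (curve (2 * t - 1)).
Proof.
move=> th; apply: tends_to_unique (tends_to_shift (cvg_curve t)) _.
under eq_fun do rewrite approxS leNgt th/=.
exact/tends_to_mul/tends_to_spiral/cvg_curve.
Qed.

(** Passing to the limit gives the second equation only for t > 1/2; at t = 1/2
    it follows from the first one, as the curve joins the two fixed points. *)
Lemma curve_refinable : refinable 10 curve.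
Proof.
have c0 : curve 0 = heis_one R.
  by apply: one_fixed; rewrite {1}curve_lower ?mulr0// invr_ge0.
have c1 : curve 1 = apex.
  apply: apex_fixed; rewrite {1}curve_upper_lt; last by lra.
  by congr (upper_half (curve _)); ring.
split.
- by move=> t /andP[_ th]; exact: curve_lower.
- move=> t /andP[+ _]; rewrite le_eqVlt => /predU1P[<-|]; last exact: curve_upper_lt.
  rewrite curve_lower// mulfV ?pnatr_eq0// subrr c0 c1.
  by rewrite upper_one.
- move=> t _; have [cx cy _] := cvg_curve t.
  have : (planar (approx k t) @[k --> \oo] --> planar (curve t)).
    by rewrite /planar; apply: cvgD; apply: cvgM.
  move=> cp; rewrite -(cvg_lim _ cp)//; apply: limr_le; first exact: cvgP cp.
  by apply: nearW => k; exact: planar_approx.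
- exists (4 * (`|H| + 2)) => t _; have [_ _ cz] := cvg_curve t.
  have cn : `|(approx k t).2| @[k --> \oo] --> `|(curve t).2| by exact: cvg_norm.
  rewrite -(cvg_lim _ cn)//; apply: limr_le; first exact: cvgP cn.
  by apply: nearW => k; exact: height_approx_le.
Qed.

(** * Increments between two points *)

Section TwoSided.
Variables (lambda : R) (g : R -> heis R).
Hypothesis lambda_ge0 : 0 <= lambda.
Hypothesis H_large : 22 * (2 * lambda + 1) + 4 <= q * H.
Hypothesis g_refinable : refinable 10 g.

Let K_ge1 : 1 <= 2 * lambda + 1.
Proof. by move: lambda_ge0; lra. Qed.

Let g22 : refinable 22 g.
Proof. by apply: refinable_weaken g_refinable; lra. Qed.

Let rev22 : refinable 22 (reversal g).
Proof. exact (reversal_refinable g_refinable). Qed.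

(** The area term is at most a quarter of the squared horizontal norms, which
    the heights dominate. The squared norm of a product is at most twice the
    sum of the squared norms, hence the factor 2 lambda + 1. *)
Lemma mul_vertical (p p' : heis R) :
  (2 * lambda + 1) * planar p <= p.2 -> (2 * lambda + 1) * planar p' <= p'.2 ->
  lambda * planar (heis_mul p p') <= (heis_mul p p').2 /\
  3 * (p.2 + p'.2) <= 4 * (heis_mul p p').2.
Proof.
move=> pv pv'; rewrite height_mul; have := area_le p p'.
have := planar_mul_le p p'; have := planar_ge0 (heis_mul p p').
have := planar_ge0 p; have := planar_ge0 p'.
move: (planar p) (planar p') (planar _) pv pv' => P P' P2 pv pv' P'0 P0 P20 P2le.
move: (2^-1 * _) => area; rewrite ler_norml => /andP[a1 a2]; have := lambda_ge0.
move=> l0; have lP := mulr_ge0 l0 P0; have lP' := mulr_ge0 l0 P'0.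
have := ler_wpM2l l0 P2le.
by split; nra.
Qed.

(** Either both points lie in the same half, and the increment is a similar
    copy of one over a parameter interval twice as long, or the midpoint lies
    between them, and the increment splits there. *)
Lemma increment_cases s t : 0 <= s -> s <= t -> t <= 1 ->
  (exists s' t', [/\ 0 <= s', s' <= t', t' <= 1, t' - s' = 2 * (t - s) &
     planar (increment (g s) (g t)) = q * planar (increment (g s') (g t')) /\
     (increment (g s) (g t)).2 = q * (increment (g s') (g t')).2]) \/
  (exists s' t', [/\ 0 <= s' <= 1, 0 <= t' <= 1, s' + t' = 2 * (t - s) &
     increment (g s) (g t) =
       heis_mul (lower_half (mirror (reversal g s')))
         (spiral 2^-1 (- y) (g t'))]).
Proof.
case: (g_refinable) => gL gU _ _ s0 st t1.
have [th|th] := lerP t 2^-1.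
  left; exists (2 * s), (2 * t); split; [lra|lra|lra|lra|].
  rewrite (gL s) ?(gL t); try by apply/andP; split; lra.
  by rewrite -spiral_increment planar_lower height_lower.
have [sh|sh] := lerP 2^-1 s.
  left; exists (2 * s - 1), (2 * t - 1); split; [lra|lra|lra|lra|].
  rewrite (gU s) ?(gU t); try by apply/andP; split; lra.
  rewrite increment_mul2l -spiral_increment.
  by rewrite planar_spiralN height_spiralN.
right; exists (1 - 2 * s), (2 * t - 1);
  split; [by apply/andP; split; lra|by apply/andP; split; lra|lra|].
rewrite (gL s) ?(gU t); try by apply/andP; split; lra.
rewrite increment_mulr -spiral_increment reversalE mirrorK.
by congr (heis_mul (spiral _ _ _) _); rewrite reversalE.
Qed.

Let half_ge_planar s' t' : 0 <= s' <= 1 -> 0 <= t' <= 1 ->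
  let p := lower_half (mirror (reversal g s')) in
  let p' := spiral 2^-1 (- y) (g t') in
  (2 * lambda + 1) * planar p <= p.2 /\ (2 * lambda + 1) * planar p' <= p'.2.
Proof.
move=> s'01 t'01 /=.
rewrite planar_lower height_lower planar_mirror height_mirror.
rewrite planar_spiralN height_spiralN.
have := height_ge_planar K_ge1 H_large rev22 s'01.
have := height_ge_planar K_ge1 H_large g22 t'01.
by have := q_gt0; split; nra.
Qed.

(** The longer of the two pieces has parameter length at least 2^-k; its height
    alone suffices. *)
Lemma straddle_lower k s' t' : 0 <= s' <= 1 -> 0 <= t' <= 1 ->
  2 * 2^-1 ^+ k <= s' + t' ->
  let p := heis_mul (lower_half (mirror (reversal g s')))
             (spiral 2^-1 (- y) (g t')) in
  lambda * planar p <= p.2 /\ q ^+ k <= 4 * p.2.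
Proof.
move=> s'01 t'01 st /=; have [pv pv'] := half_ge_planar s'01 t'01.
have [mv mh] := mul_vertical pv pv'; split=> //.
move: mh; rewrite height_lower height_spiralN height_mirror => mh.
have growth : q ^+ k <= (reversal g s').2 + (g t').2.
  have rev0 := height_ge0 K_ge1 H_large rev22 s'01.
  have g0 := height_ge0 K_ge1 H_large g22 t'01.
  move: s'01 t'01 => /andP[_ s'1] /andP[_ t'1].
  have [ks|ks] := lerP (2^-1 ^+ k) s'.
    have := @height_growth _ _ K_ge1 H_large rev22 k s'.
    by rewrite ks s'1 => /(_ isT); lra.
  have kt : 2^-1 ^+ k <= t' by move: st ks; move: (2^-1 ^+ k) => e; lra.
  have := @height_growth _ _ K_ge1 H_large g22 k t'.
  by rewrite kt t'1 => /(_ isT); lra.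
by have := q_exp_ge0 k; have := q_ge; nra.
Qed.

(** At most k doublings put two parameters at distance at least 2^-k on
    different sides of the midpoint. *)
Lemma increment_lower k s t : 0 <= s -> t <= 1 -> 2^-1 ^+ k <= t - s ->
  lambda * planar (increment (g s) (g t)) <= (increment (g s) (g t)).2 /\
  q ^+ k <= 4 * (increment (g s) (g t)).2.
Proof.
elim: k s t => [|k IH] s t s0 t1 stk;
  have st : s <= t by rewrite -subr_ge0 (le_trans _ stk)// exprn_ge0// invr_ge0.
- have [[s' [t' [s'0 s't' t'1 st' _]]]|[s' [t' [s'01 t'01 st' ->]]]] :=
    increment_cases s0 st t1.
    by move: stk; rewrite expr0; lra.
  by apply: straddle_lower => //; rewrite st' ler_pM2l.
- have [[s' [t' [s'0 s't' t'1 st' [-> ->]]]]|[s' [t' [s'01 t'01 st' ->]]]] :=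
    increment_cases s0 st t1.
    have /(IH _ _ s'0 t'1)[] : 2^-1 ^+ k <= t' - s'.
      by move: stk; rewrite st' exprS; move: (2^-1 ^+ k) => e; lra.
    by have := q_gt0; rewrite exprS; split; nra.
  by apply: straddle_lower => //; rewrite st' ler_pM2l.
Qed.

Lemma increment_vertical s t : 0 <= s -> s <= t -> t <= 1 ->
  lambda * planar (increment (g s) (g t)) <= (increment (g s) (g t)).2.
Proof.
move=> s0; rewrite le_eqVlt => /predU1P[<- _|st t1].
  by rewrite increment_self /planar/= expr0n/= addr0 mulr0.
have [k kst] : exists k, 2^-1 ^+ k <= t - s by apply: exists_dyadic_le; rewrite subr_gt0.
by have [] := increment_lower s0 t1 kst.
Qed.

(** Two parameters at distance at most 2^-k.+1 are either in the same half, or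
    both within 2^-k.+1 of the midpoint, so that the bounds on initial pieces
    apply to both factors. *)
Lemma increment_upper : exists2 C, 0 <= C & forall k s t,
  0 <= s -> s <= t -> t <= 1 -> t - s <= 2^-1 ^+ k ->
  planar (increment (g s) (g t)) <= C * q ^+ k /\
  `|(increment (g s) (g t)).2| <= C * q ^+ k.
Proof.
have [M M0 gM] := one_sided_upper g22.
have [M' M'0 gM'] := one_sided_upper rev22.
have [C0 C00 bound0] : exists2 C, 0 <= C & forall s t, 0 <= s -> s <= t -> t <= 1 ->
    planar (increment (g s) (g t)) <= C /\ `|(increment (g s) (g t)).2| <= C.
  exists (4 * M) => [|s t s0 st t1]; first by lra.
  have [|sP sz] := gM 0%N s; first by rewrite expr0; apply/andP; split; lra.
  have [|tP tz] := gM 0%N t; first by rewrite expr0; apply/andP; split; lra.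
  move: sP sz tP tz; rewrite expr0 mulr1 => sP sz tP tz.
  split; first by apply: le_trans (planar_increment_le _ _) _; lra.
  by apply: le_trans (height_increment_le _ _) _; lra.
exists (C0 + 2 * (M + M')); first by lra.
elim=> [|k IH] s t s0 st t1 stk.
  by have [] := bound0 _ _ s0 st t1; rewrite expr0 mulr1; split; lra.
have qk := q_exp_ge0 k.
have [[s' [t' [s'0 s't' t'1 st' [-> ->]]]]|[s' [t' [s'01 t'01 st' ->]]]] :=
    increment_cases s0 st t1.
  have [] : _ /\ _ := IH _ _ s'0 s't' t'1 _.
    by move: stk; rewrite st' exprS; move: (2^-1 ^+ k) => e; lra.
  rewrite normrM (ger0_norm (ltW q_gt0)) exprS.
  by have := q_gt0; move: (_ ^+ k) (_ + _ * _) => *; split; nra.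
move: s'01 t'01 => /andP[s'0 s'1] /andP[t'0 t'1].
have [|sP sz] := gM' k s'.
  by rewrite s'0; move: stk; rewrite exprS; move: (2^-1 ^+ k) => e; lra.
have [|tP tz] := gM k t'.
  by rewrite t'0; move: stk; rewrite exprS; move: (2^-1 ^+ k) => e; lra.
have q0 := ltW q_gt0.
move: (ler_wpM2l q0 sP) (ler_wpM2l q0 sz) (ler_wpM2l q0 tP) (ler_wpM2l q0 tz).
move: (mulr_ge0 q0 (mulr_ge0 C00 qk)) (mulr_ge0 q0 (mulr_ge0 M0 qk)).
move: (mulr_ge0 q0 (mulr_ge0 M'0 qk)) => {sP sz tP tz} *.
split.
  apply: le_trans (planar_mul_le _ _) _.
  rewrite planar_lower planar_spiralN planar_mirror exprS.
  by lra.
rewrite height_mul (le_trans (ler_normD _ _))//.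
have := area_le (lower_half (mirror (reversal g s'))) (spiral 2^-1 (- y) (g t')).
rewrite planar_lower planar_spiralN planar_mirror.
have := ler_normD (lower_half (mirror (reversal g s'))).2 (spiral 2^-1 (- y) (g t')).2.
rewrite height_lower height_spiralN height_mirror.
rewrite !(normrM q) (ger0_norm (ltW q_gt0)) exprS.
by move: (2^-1 * _) => area; lra.
Qed.

End TwoSided.
End Curve.

(** * Bounds for the Hausdorff dimension *)

Section HausdorffBounds.
Variables (R : realType) (T : Type) (d : T -> T -> R).

Lemma hausdorff_gauge_ge0 s (U : set T) : (0 <= hausdorff_gauge d s U)%E.
Proof. by rewrite /hausdorff_gauge; case: ifP => // _; exact: poweR_ge0. Qed.

Lemma diam_le (U : set T) (D : R) :
  (forall p p', U p -> U p' -> d p p' <= D) -> (diam d U <= D%:E)%E.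
Proof.
by move=> UD; apply/ereal_supP => _ [[p p'] [/= Up Up'] <-]; rewrite lee_fin UD.
Qed.

Lemma dist_le_diam (U : set T) p p' : U p -> U p' -> ((d p p')%:E <= diam d U)%E.
Proof. by move=> Up Up'; apply: ereal_sup_ubound; exists (p, p'). Qed.

Lemma hausdorff_premeasure_ge0 s delta A : (0 <= hausdorff_premeasure d s delta A)%E.
Proof.
apply/ereal_infP => _ [U _ <-]; apply: nneseries_ge0 => i _ _.
exact: hausdorff_gauge_ge0.
Qed.

(** Nonnegativity of d on the diagonal gives nonempty sets a nonnegative
    diameter, on which the power is monotone. *)
Lemma hausdorff_gauge_le s (U : set T) (D : R) : 0 < s -> 0 <= D ->
  (forall p, 0 <= d p p) ->
  (diam d U <= D%:E)%E -> (hausdorff_gauge d s U <= (D `^ s)%:E)%E.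
Proof.
move=> s0 D0 d0 UD; rewrite /hausdorff_gauge; case: asboolP => [_|/eqP/set0P[p Up]].
  by rewrite lee_fin powR_ge0.
rewrite -poweR_EFin; apply: gt0_ler_poweR => //; first exact: ltW.
  rewrite in_itv/= leey andbT (le_trans _ (dist_le_diam Up Up))// lee_fin.
  exact: d0.
by rewrite in_itv/= leey andbT lee_fin.
Qed.

Lemma hausdorff_measure_eq0 s (A : set T) (N : nat -> nat) (U : nat -> nat -> set T)
    (D : nat -> R) : 0 < s -> (forall p, 0 <= d p p) -> (forall k, 0 <= D k) ->
  (forall k, A `<=` \bigcup_(i in [set i | (i < N k)%N]) U k i) ->
  (forall k i, (i < N k)%N -> (diam d (U k i) <= (D k)%:E)%E) ->
  D k @[k --> \oo] --> 0 -> (N k)%:R * D k `^ s @[k --> \oo] --> 0 ->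
  hausdorff_measure d s A = 0%E.
Proof.
move=> s0 d0 D0 AU UD cD cN; apply/eqP; rewrite eq_le; apply/andP; split; last first.
  apply: le_ereal_sup_tmp; exists (hausdorff_premeasure d s 1 A).
    by exists 1 => //=; exact: ltr01.
  exact: hausdorff_premeasure_ge0.
apply/ereal_supP => _ [delta /= delta0 <-]; apply/lee_addgt0Pr => e e0; rewrite add0e.
have [k [Dk Nk]] : exists k, D k <= delta /\ (N k)%:R * D k `^ s <= e.
  have nD : \forall k \near \oo, D k <= delta by exact: (cvgr_le _ cD).
  have nN : \forall k \near \oo, (N k)%:R * D k `^ s <= e by exact: (cvgr_le _ cN).
  have [k [? ?]] := filter_ex (filterI nD nN).
  by exists k.
(* The finite cover is continued by empty sets, which have gauge 0. *)
pose V i := if (i < N k)%N then U k i else set0.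
have gV i : (hausdorff_gauge d s (V i) <= if (i < N k)%N then (D k `^ s)%:E else 0)%E.
  rewrite /V; case: ifPn => [ik|_]; last by rewrite /hausdorff_gauge; case: asboolP.
  by apply: hausdorff_gauge_le => //; exact: UD.
apply: ge_ereal_inf; exists (\sum_(0 <= i <oo) hausdorff_gauge d s (V i))%E.
  exists V => //; split.
    by move=> p /(AU k)[i /= ik Up]; exists i => //; rewrite /V ik.
  move=> i; rewrite /V; case: ifPn => ik; first by rewrite (le_trans (UD _ _ ik))// lee_fin.
  by apply/ereal_supP => x [[p p'] []].
apply: lime_le; first by apply: is_cvg_nneseries => i _ _; exact: hausdorff_gauge_ge0.
apply: nearW => n.
apply: (@le_trans _ _ (\sum_(0 <= i < n) (if (i < N k)%N then (D k `^ s)%:E else 0))%E).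
  by apply: lee_sum => i _; exact: gV.
apply: (@le_trans _ _ ((N k)%:R * D k `^ s)%:E); last by rewrite lee_fin.
apply: (@le_trans _ _ ((minn n (N k))%:R * D k `^ s)%:E); last first.
  by rewrite lee_fin ler_wpM2r ?powR_ge0// ler_nat geq_minr.
elim: n => [|n IH]; first by rewrite big_geq// min0n mul0r.
rewrite big_nat_recr//=; apply: (le_trans (leeD2r _ IH)).
case: ifPn => nN; last by rewrite adde0 lee_fin ler_wpM2r ?powR_ge0// ler_nat; lia.
have -> : minn n.+1 (N k) = (minn n (N k)).+1 by lia.
by rewrite -EFinD lee_fin -natr1 mulrDl mul1r.
Qed.

Lemma hausdorff_dim_le s (A : set T) : 0 <= s -> hausdorff_measure d s A = 0%E ->
  (hausdorff_dim d A <= s%:E)%E.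
Proof. by move=> s0 sA; apply: ereal_inf_lbound; exists s. Qed.

(** If the s-measure vanished for some s < s0, there would be a cover with a
    small sum of diam(U i)^s. The parameters of the points in U i lie in an
    interval of length at most 2 C diam(U i)^s0, and diam(U i)^s0 is at most
    diam(U i)^s because the diameters are at most 1. So the intervals would
    cover [0, 1] with total length less than 1. *)
Lemma hausdorff_dim_ge (s0 C : R) (g : R -> T) : 0 < s0 -> 0 < C ->
  (forall p p', 0 <= d p p') ->
  (forall s t, 0 <= s <= 1 -> 0 <= t <= 1 -> `|t - s| <= C * d (g s) (g t) `^ s0) ->
  (s0%:E <= hausdorff_dim d (g @` `[0%R, 1%R]%classic))%E.
Proof.
move=> s0_gt0 C0 d0 gC; apply/ereal_infP => _ [s [/= s_ge0 sA] <-].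
rewrite lee_fin leNgt; apply/negP => ss0.
have /ereal_inf_lt[_ [U [AU U1] <-]] :
    (hausdorff_premeasure d s 1 (g @` `[0%R, 1%R]%classic) < (4 * C)^-1%:E)%E.
  apply: (@le_lt_trans _ _ 0%E); last by rewrite lte_fin invr_gt0 mulr_gt0.
  by rewrite -sA; apply: ereal_sup_ubound; exists 1 => //=; exact: ltr01.
apply/negP; rewrite -leNgt.
(* An interval centred at the parameter of some point of the curve in U i. *)
pose F i : set R := if pselect (exists2 t, 0 <= t <= 1 & U i (g t)) is left h
  then let t := projT1 (cid2 h) in
       let l := C * (fine (diam d (U i))) `^ s0 in `[t - l, t + l]%classic
  else set0.
have FU t i : 0 <= t <= 1 -> U i (g t) -> F i t.
  move=> t01 Ut; rewrite /F; case: pselect => [h|]; last by case; exists t.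
  case: cid2 => /= t' t'01 Ut'.
  have dfin : (d (g t') (g t) <= fine (diam d (U i))).
    rewrite -lee_fin fineK ?dist_le_diam// ge0_fin_numE.
      by rewrite (le_lt_trans (U1 i))// ltry.
    by rewrite (le_trans _ (dist_le_diam Ut' Ut)) ?lee_fin.
  have := gC _ _ t'01 t01.
  have : C * d (g t') (g t) `^ s0 <= C * fine (diam d (U i)) `^ s0.
    rewrite ler_pM2l//; apply: ge0_ler_powR => //; first exact: ltW.
      by rewrite nnegrE.
    by rewrite nnegrE (le_trans _ dfin).
  rewrite in_itv/= ler_norml => h1 /andP[h2 h3]; apply/andP; split; lra.
have Fm i : measurable (F i).
  by rewrite /F; case: pselect => // h; exact: measurable_itv.
have muF i : (lebesgue_measure (F i) <= (2 * C)%:E * hausdorff_gauge d s (U i))%E.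
  have gauge0 := hausdorff_gauge_ge0 s (U i).
  rewrite /F; case: pselect => [h|_]; last first.
    by rewrite measure0 mule_ge0// lee_fin mulr_ge0// ltW.
  case: cid2 => /= t t01 Ut; rewrite lebesgue_measure_itv/= lte_fin.
  have diam0 : (0 <= diam d (U i))%E.
    by rewrite (le_trans _ (dist_le_diam Ut Ut)) ?lee_fin.
  have diamfin : diam d (U i) \is a fin_num.
    by rewrite ge0_fin_numE// (le_lt_trans (U1 i))// ltry.
  case: ifP => _; last by rewrite mule_ge0// lee_fin mulr_ge0// ltW.
  rewrite /hausdorff_gauge; case: asboolP => [U0|_]; first by rewrite U0 in Ut.
  move: (U1 i) diam0; rewrite -(fineK diamfin) poweR_EFin /= !lee_fin.
  move: (fine _) => D D1 D0.
  have : D `^ s0 <= D `^ s.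
    move: D0; rewrite le_eqVlt => /predU1P[<-|D0].
      by rewrite powR0 ?powR_ge0// gt_eqF.
    by apply: ger_powR; [rewrite D0|exact: ltW].
  by move=> DD; have := ler_wpM2l (ltW C0) DD; lra.
have : (lebesgue_measure (`[0%R, 1%R]%classic : set R) <=
    \sum_(0 <= i <oo) lebesgue_measure (F i))%E.
  apply: measure_sigma_subadditive => //.
  move=> t /=; rewrite in_itv/= => t01.
  have [|i _ Ut] := AU (g t); first by exists t => //=; rewrite in_itv.
  by exists i => //; exact: FU.
rewrite lebesgue_measure_itv/= lte_fin ltr01 -EFinB subr0 => le1.
rewrite -(@lee_pmul2l _ (2 * C)%:E) ?lte_fin ?mulr_gt0//.
rewrite -nneseriesZl; last by move=> i _; exact: hausdorff_gauge_ge0.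
apply: (@le_trans _ _ 1%E).
  rewrite -EFinM lee_fin; rewrite invfM mulrACA mulfV ?gt_eqF// mulr1.
  lra.
apply: le_trans le1 _; apply: lee_nneseries => // i _; exact: measure_ge0.
Qed.

End HausdorffBounds.

(** * The Koranyi norm *)

Section Koranyi.
Variable R : realType.
Implicit Types p : heis R.

Lemma koranyi_ge0 p : 0 <= koranyi p.
Proof. by case: p => [[x y] z]; exact: powR_ge0. Qed.

Lemma koranyi_exp4 p : koranyi p ^+ 4 = planar p ^+ 2 + 16 * p.2 ^+ 2.
Proof.
case: p => [[x y] z]; rewrite /koranyi /planar/=.
rewrite -powR_mulrn ?powR_ge0// -powRrM mulVf ?pnatr_eq0// powRr1//.
by rewrite addr_ge0 ?sqr_ge0// mulr_ge0 ?sqr_ge0.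
Qed.

Lemma koranyi_inv p : koranyi (heis_inv p) = koranyi p.
Proof. by case: p => [[x y] z] /=; rewrite !sqrrN. Qed.

Lemma heis_distC p p' : heis_dist p p' = heis_dist p' p.
Proof. by rewrite /heis_dist -[LHS]koranyi_inv -incrementC. Qed.

(** Fourth powers avoid roots; B^4 >= B lets one constant serve. *)
Lemma koranyi_le p (B e : R) : 1 <= B -> 0 <= e ->
  17 * (planar p) ^+ 2 <= B * e ^+ 4 -> 17 * p.2 ^+ 2 <= B * e ^+ 4 ->
  koranyi p <= B * e.
Proof.
move=> B1 e0 pB zB.
have B0 : 0 <= B by lra.
rewrite -(@ler_pXn2r _ 4) ?nnegrE ?koranyi_ge0 ?mulr_ge0// koranyi_exp4.
apply: (@le_trans _ _ (B * e ^+ 4)); first by lra.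
by rewrite exprMn ler_wpM2r ?exprn_ge0// ler_eXnr.
Qed.

Lemma koranyi_sqr_ge p : 4 * p.2 <= koranyi p ^+ 2.
Proof.
have [z0|z0] := ltP p.2 0.
  by have := sqr_ge0 (koranyi p); lra.
rewrite -(@ler_pXn2r _ 2) ?nnegrE ?sqr_ge0 ?mulr_ge0// -exprM koranyi_exp4.
by have := sqr_ge0 (planar p); lra.
Qed.

End Koranyi.

(** * Topology and dimension of the image *)

Lemma dyadic_modulus_continuous (R : realType) (B r : R) (f : R -> R) : 0 <= r < 1 ->
  (forall k s t, 0 <= s -> s <= t -> t <= 1 -> t - s <= 2^-1 ^+ k ->
    `|f t - f s| <= B * r ^+ k) ->
  forall x : R, 0 <= x <= 1 -> f @ within `[0, 1] (nbhs x) --> f x.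
Proof.
move=> r01 fB x /andP[x0 x1]; apply/cvgrPdist_le => e e0.
have [k Bk] : exists k, B * r ^+ k <= e.
  have ne : \forall k \near \oo, B * r ^+ k <= e.
    exact: (cvgr_le _ (geometric_cvg0 B r01)).
  by have [k ?] := filter_ex ne; exists k.
rewrite near_withinE; apply/nbhs_ballP; exists (2^-1 ^+ k) => /=.
  by rewrite exprn_gt0// invr_gt0.
move=> t; rewrite -ball_normE/= in_itv/= => xt /andP[t0 t1].
apply: le_trans Bk; have [tx|xt'] := lerP t x.
  by apply: fB => //; rewrite (le_trans (ler_norm _))// ltW.
rewrite distrC; apply: fB => //; first exact: ltW.
by rewrite (le_trans (ler_norm _))// distrC ltW.
Qed.

Section ArcImage.
Variables (R : realType) (lambda q : R) (g : R -> heis R).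
Hypotheses (q_gt0 : 0 < q) (q_lt1 : q < 1).

Definition arc : set (heis R) := g @` `[0, 1].

Lemma arc_vertical :
  (forall s t, 0 <= s -> s <= t -> t <= 1 ->
     lambda * planar (increment (g s) (g t)) <= (increment (g s) (g t)).2) ->
  vertical_curve lambda arc.
Proof.
move=> gV p [s /= s01 <-] p' [t /= t01 <-] {p p'}.
move: s01 t01; rewrite !in_itv/= => /andP[s0 s1] /andP[t0 t1].
exists (increment (g s) (g t)); last exact: mul_increment.
have VConeE p : lambda * planar p <= `|p.2| -> VCone lambda p by case: p => [[]].
apply: VConeE; have [st|ts] := lerP s t.
  by apply: le_trans (gV _ _ s0 st t1) _; exact: ler_norm.
have := gV _ _ t0 (ltW ts) s1; rewrite [increment (g s) (g t)]incrementC.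
case: (increment (g t) (g s)) => [[a b] c]; rewrite /planar/= !sqrrN normrN => /le_trans.
by apply; exact: ler_norm.
Qed.

Section Upper.
Variable C : R.
Hypothesis C_ge0 : 0 <= C.
Hypothesis g0 : g 0 = heis_one R.
Hypothesis g_upper : forall k s t,
  0 <= s -> s <= t -> t <= 1 -> t - s <= 2^-1 ^+ k ->
  planar (increment (g s) (g t)) <= C * q ^+ k /\
  `|(increment (g s) (g t)).2| <= C * q ^+ k.

Let r := Num.sqrt q.

Let r_ge0 : 0 <= r. Proof. exact: sqrtr_ge0. Qed.
Let sqr_r : r ^+ 2 = q. Proof. by rewrite sqr_sqrtr// ltW. Qed.
Let r_lt1 : r < 1.
Proof. by rewrite -(@ltr_pXn2r _ 2)// ?nnegrE// sqr_r expr1n. Qed.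
Let q_exp k : q ^+ k = (r ^+ k) ^+ 2.
Proof. by rewrite -sqr_r -!exprM mulnC. Qed.

(** The group increment controls the differences of coordinates; for the height
    this uses that the starting point is bounded and Cauchy-Schwarz for the
    area term. *)
Lemma arc_coordinates k s t : 0 <= s -> s <= t -> t <= 1 -> t - s <= 2^-1 ^+ k ->
  [/\ `|(g t).1.1 - (g s).1.1| <= (2 * C + 1) * r ^+ k,
      `|(g t).1.2 - (g s).1.2| <= (2 * C + 1) * r ^+ k &
      `|(g t).2 - (g s).2| <= (2 * C + 1) * r ^+ k].
Proof.
move=> s0 st t1 stk; have [] := g_upper s0 st t1 stk.
have [|gsP _] := @g_upper 0%N 0 s (lexx _) s0 (le_trans st t1).
  by rewrite expr0 subr0 (le_trans st t1).
move: gsP; rewrite g0 increment1 expr0 mulr1.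
have e0 : 0 <= r ^+ k by exact: exprn_ge0.
have e1 : r ^+ k <= 1 by rewrite exprn_ile1// ltW.
have gt : g t = heis_mul (g s) (increment (g s) (g t)) by rewrite mul_increment.
rewrite {3 4 5}gt q_exp.
move: (r ^+ k) e0 e1 => e e0 e1.
move: (g s) (increment (g s) (g t)) {gt} => [[a b] c] [[u v] w]; rewrite /planar/=.
move=> ab uv; rewrite ler_norml => /andP[w1 w2].
have u2 := sqr_ge0 u; have v2 := sqr_ge0 v; have a2 := sqr_ge0 a.
have C2 := sqr_ge0 C.
have Ce2 : 0 <= C * e ^+ 2 by rewrite mulr_ge0 ?sqr_ge0.
have ee : e ^+ 2 <= e by rewrite expr2 ler_piMl.
have Cee : C * e ^+ 2 <= C * e by exact: ler_wpM2l.
have sq : C * e ^+ 2 <= ((2 * C + 1) * e) ^+ 2.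
  have -> : ((2 * C + 1) * e) ^+ 2 =
      C * e ^+ 2 + (4 * (C * e) ^+ 2 + 3 * (C * e ^+ 2) + e ^+ 2) by ring.
  by rewrite lerDl; have := sqr_ge0 e; have := sqr_ge0 (C * e); lra.
have Be : 0 <= (2 * C + 1) * e by rewrite mulr_ge0//; have := C_ge0; lra.
split.
- by rewrite addrAC subrr add0r; apply: norm_le_sqr => //; lra.
- by rewrite addrAC subrr add0r; apply: norm_le_sqr => //; lra.
- have area : `|2^-1 * (a * v - u * b)| <= C * e.
    apply: norm_le_sqr; first exact: mulr_ge0.
    have : (a * v - u * b) ^+ 2 <= (a ^+ 2 + b ^+ 2) * (u ^+ 2 + v ^+ 2).
      by have := sqr_ge0 (a * u + b * v); nra.
    have : (a ^+ 2 + b ^+ 2) * (u ^+ 2 + v ^+ 2) <= C * (C * e ^+ 2).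
      by apply: ler_pM => //; rewrite addr_ge0 ?sqr_ge0.
    have -> : (C * e) ^+ 2 = C * (C * e ^+ 2) by ring.
    by have := sqr_ge0 (a * v - u * b); lra.
  move: area; rewrite !ler_norml => /andP[? ?]; apply/andP; split; lra.
Qed.

Lemma arc_connected : connected arc.
Proof.
apply: connected_continuous_connected; first exact: segment_connected.
apply/subspace_continuousP => x /=; rewrite in_itv/= => x01.
have r01 : 0 <= r < 1 by rewrite r_ge0.
have gE : (fun t => ((g t).1.1, (g t).1.2, (g t).2)) = g.
  by apply/funext => t; case: (g t) => [[]].
suff : (fun t => ((g t).1.1, (g t).1.2, (g t).2)) @ within `[0, 1] (nbhs x)
    --> ((g x).1.1, (g x).1.2, (g x).2) by rewrite gE -!surjective_pairing.
apply: (@cvg_pair _ _ _ _ (nbhs ((g x).1.1, (g x).1.2)) (nbhs (g x).2)).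
  apply: (@cvg_pair _ _ _ _ (nbhs (g x).1.1) (nbhs (g x).1.2)).
- apply: (dyadic_modulus_continuous (B := 2 * C + 1) (f := fun t => (g t).1.1) r01 _ x01).
  by move=> k s t s0 st t1 stk; have [+ _ _] := arc_coordinates s0 st t1 stk.
- apply: (dyadic_modulus_continuous (B := 2 * C + 1) (f := fun t => (g t).1.2) r01 _ x01).
  by move=> k s t s0 st t1 stk; have [_ + _] := arc_coordinates s0 st t1 stk.
- apply: (dyadic_modulus_continuous (B := 2 * C + 1) (f := fun t => (g t).2) r01 _ x01).
  by move=> k s t s0 st t1 stk; have [_ _ +] := arc_coordinates s0 st t1 stk.
Qed.

Let B := 17 * C ^+ 2 + 1.

Lemma arc_dist_le k s t : 0 <= s <= 1 -> 0 <= t <= 1 -> `|t - s| <= 2^-1 ^+ k ->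
  heis_dist (g s) (g t) <= B * r ^+ k.
Proof.
wlog st : s t / s <= t => [wl|] s01 t01 stk.
  have [st|ts] := lerP s t; first exact: wl.
  by rewrite heis_distC; apply: wl => //; [exact: ltW|rewrite distrC].
move: s01 t01 stk => /andP[s0 _] /andP[_ t1]; rewrite ger0_norm ?subr_ge0// => stk.
have [gP gz] := g_upper s0 st t1 stk.
have B1 : 1 <= B by rewrite /B; have := sqr_ge0 C; lra.
have r4 : 17 * (C * q ^+ k) ^+ 2 <= B * (r ^+ k) ^+ 4.
  rewrite q_exp exprMn -(exprM _ 2 2) mulrA ler_wpM2r ?exprn_ge0//.
  by rewrite /B; lra.
rewrite heis_distC /heis_dist -/(increment (g s) (g t)).
apply: koranyi_le => //; first exact: exprn_ge0.
  by apply: le_trans r4; rewrite ler_pM2l// ler_sqr ?nnegrE ?planar_ge0 ?(le_trans (planar_ge0 _) gP).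
apply: le_trans r4; rewrite ler_pM2l// -(real_normK (num_real _)).
by rewrite ler_sqr ?nnegrE ?(le_trans (normr_ge0 _) gz).
Qed.

Lemma arc_dim_lt2 : 2 * q < 1 -> (hausdorff_dim (@heis_dist R) arc < 2%:E)%E.
Proof.
move=> q2.
have r_gt0 : 0 < r by rewrite sqrtr_gt0.
(* The similarity dimension of the arc is ln 2 / L; the exponent s is the
   midpoint of ln 2 / L and 2. *)
pose L := - ln r; pose s := 1 + ln 2 / (2 * L).
have ln2_gt0 : 0 < ln 2 :> R by rewrite ln_gt0// ltr1n.
have L_gt : ln 2 < 2 * L.
  have : ln (2 * q) < 0 by apply: ln_lt0; rewrite mulr_gt0.
  by rewrite lnM ?posrE// -sqr_r lnXn// mulr_natl /L; lra.
have L_gt0 : 0 < 2 * L by exact: lt_trans L_gt.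
have s_half : ln 2 / (2 * L) < 1 by rewrite ltr_pdivrMr// mul1r.
have s_gt0 : 0 < s by rewrite /s addr_gt0// divr_gt0.
have rate_lt1 : 2 * r `^ s < 1.
  rewrite -[X in X * _](@lnK _ 2) ?posrE// /powR gt_eqF// -expRD expR_lt1.
  have : s * (2 * L) = 2 * L + ln 2 by rewrite /s mulrDl mul1r divfK// gt_eqF.
  by move: L_gt; rewrite /L; lra.
have B_ge0 : 0 <= B by rewrite /B; have := sqr_ge0 C; lra.
have r01 : 0 <= r < 1 by rewrite r_ge0.
apply: (@le_lt_trans _ _ s%:E); last by rewrite lte_fin /s; lra.
apply: hausdorff_dim_le; first exact: ltW.
pose U k i := g @` [set t : R | 0 <= t <= 1 /\
  i%:R * 2^-1 ^+ k <= t <= i.+1%:R * 2^-1 ^+ k].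
apply: (@hausdorff_measure_eq0 _ _ _ s arc (fun k => (2 ^ k)%N) U
  (fun k => B * r ^+ k)) => //.
- by move=> p; exact: koranyi_ge0.
- by move=> k; rewrite mulr_ge0// exprn_ge0.
- move=> k p [t /=]; rewrite in_itv/= => t01 <- {p}.
  by have [i ik it] := dyadic_cell k t01; exists i => //; exists t.
- move=> k i _; apply: diam_le => p p' [t /= [t01 it] <-] [t' /= [t'01 it'] <-] {p p'}.
  apply: arc_dist_le => //; rewrite ler_norml.
  move: it it'; rewrite -natr1; move: (2^-1 ^+ k) => e /andP[? ?] /andP[? ?].
  by apply/andP; split; lra.
- exact: geometric_cvg0.
- have -> : (fun k => (2 ^ k)%:R * (B * r ^+ k) `^ s) =
      (fun k => B `^ s * (2 * r `^ s) ^+ k).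
    apply/funext => k; rewrite powRM ?exprn_ge0// natrX exprMn.
    by rewrite -(powR_mulrn k r_ge0) powRAC powR_mulrn ?powR_ge0//; ring.
  by apply: geometric_cvg0; rewrite rate_lt1 mulr_ge0// powR_ge0.
Qed.

End Upper.

Lemma arc_dim_gt2 : (forall k s t, 0 <= s -> t <= 1 -> 2^-1 ^+ k <= t - s ->
     q ^+ k <= 4 * (increment (g s) (g t)).2) -> 1 < 2 * q ->
  (2%:E < hausdorff_dim (@heis_dist R) arc)%E.
Proof.
move=> growth q2.
(* This is the exponent for which q ^ (s0 / 2) = 1/2. *)
pose L := - ln q; pose s0 := 2 * ln 2 / L.
have L_gt0 : 0 < L by rewrite oppr_gt0 ln_lt0// q_gt0.
have ln2L : L < ln 2.
  have : 0 < ln (2 * q) by exact: ln_gt0.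
  by rewrite lnM ?posrE// /L; lra.
have s0_gt2 : 2 < s0 by rewrite /s0 ltr_pdivlMr// ltr_pM2l.
have qs0 : q `^ (s0 / 2) = 2^-1.
  rewrite /powR gt_eqF//; have -> : s0 / 2 * ln q = - ln 2.
    rewrite /s0 -[ln q]opprK -/L mulrN; congr (- _).
    by rewrite mulrAC divfK ?gt_eqF// mulrAC mulfV ?pnatr_eq0// mul1r.
  by rewrite expRN lnK// posrE.
apply: (@lt_le_trans _ _ s0%:E); first by rewrite lte_fin.
apply: (@hausdorff_dim_ge _ _ _ s0 2) => //; first by lra.
  by move=> *; exact: koranyi_ge0.
suff le_dist s t : 0 <= s -> s <= t -> t <= 1 ->
    t - s <= 2 * heis_dist (g s) (g t) `^ s0.
  move=> s t /andP[s_ge0 s_le1] /andP[t_ge0 t_le1]; have [st|ts] := lerP s t.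
    exact: le_dist.
  by rewrite heis_distC; apply: le_dist => //; exact: ltW.
move=> s_ge0 + t1; rewrite le_eqVlt => /predU1P[->|st].
  by rewrite subrr mulr_ge0// powR_ge0.
(* The first dyadic scale below t - s is at least half of t - s. *)
have ex_k : exists k, 2^-1 ^+ k <= t - s by apply: exists_dyadic_le; rewrite subr_gt0.
case: (ex_minnP ex_k) => k kst k_min.
have kt : t - s <= 2 * 2^-1 ^+ k.
  case: k k_min {kst} => [|k] k_min; first by rewrite expr0; lra.
  rewrite exprS mulrA mulfV ?pnatr_eq0// mul1r leNgt; apply/negP => /ltW /k_min.
  by rewrite ltnn.
apply: le_trans kt _; rewrite ler_pM2l//.
rewrite heis_distC /heis_dist -/(increment (g s) (g t)).
have qd := le_trans (growth k s t s_ge0 t1 kst) (koranyi_sqr_ge _).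
move: (koranyi_ge0 (increment (g s) (g t))) qd => d0 qd.
have -> : koranyi (increment (g s) (g t)) `^ s0 =
    (koranyi (increment (g s) (g t)) ^+ 2) `^ (s0 / 2).
  by rewrite -powR_mulrn// -powRrM mulrC divfK// pnatr_eq0.
have <- : (q ^+ k) `^ (s0 / 2) = 2^-1 ^+ k.
  by rewrite -powR_mulrn ?(ltW q_gt0)// powRAC qs0 powR_mulrn// invr_ge0.
apply: ge0_ler_powR => //; last by rewrite nnegrE sqr_ge0.
  by rewrite divr_ge0//; lra.
by rewrite nnegrE exprn_ge0// ltW.
Qed.

End ArcImage.

(** * The two curves *)

(** With y = 1/2 + e or y = -1/2 + e and e small, 4y^2 - 1 is close to 4e or
    -4e, and H = y / (4y^2 - 1) is close to 1 / (8e) in both cases. *)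
Lemma curve_parameters (R : realType) (M : R) (above : bool) : 1 <= M ->
  exists y H q, [/\ 1 + 4 * y ^+ 2 = 4 * q, 4 * q * H - y = 2 * H,
    7 <= 16 * q, 16 * q <= 9 & M <= q * H] /\
    if above then 1 < 2 * q else 2 * q < 1.
Proof.
move=> M1; pose e : R := (64 * M)^-1.
have eM : 64 * (e * M) = 1 by rewrite /e; field; rewrite gt_eqF//; lra.
have e0 : 0 < e by rewrite invr_gt0 mulr_gt0//; lra.
have e64 : 64 * e <= 1 by nra.
clearbody e.
suff [y [y_ge y_le y_M y_above]] : exists y : R, [/\ 3 <= 16 * y ^+ 2,
    16 * y ^+ 2 <= 5, 4 * M <= y / (4 * y ^+ 2 - 1) &
    if above then 1 < 4 * y ^+ 2 else 4 * y ^+ 2 < 1].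
  have d_neq0 : 4 * y ^+ 2 - 1 != 0.
    by case: above y_above => y1; [rewrite gt_eqF|rewrite lt_eqF]; lra.
  exists y, (y / (4 * y ^+ 2 - 1)), (4^-1 + y ^+ 2); split; last first.
    by case: above y_above => y1; lra.
  split; [by field|by field|by lra|by lra|].
  by move: y_M; move: (y / _) => H HM; nra.
case: above.
- have ee : 0 < e * (1 + e) by nra.
  exists (2^-1 + e).
  have -> : (2^-1 + e) ^+ 2 = 4^-1 + e * (1 + e) by field.
  split; [by nra|by nra| |by lra].
  rewrite ler_pdivlMr; last by lra.
  by nra.
- have ee : 0 < e * (1 - e) by nra.
  exists (- (2^-1 - e)).
  have -> : (- (2^-1 - e)) ^+ 2 = 4^-1 - e * (1 - e) by field.
  split; [by nra|by nra| |by lra].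
  rewrite ler_ndivlMr; last by lra.
  by nra.
Qed.

Lemma arc_exists (R : realType) (lambda : R) (above : bool) : 0 < lambda ->
  exists E : set (heis R), [/\ connected E, vertical_curve lambda E,
    exists p q : heis R, [/\ E p, E q & p <> q] &
    if above then (2%:E < hausdorff_dim (@heis_dist R) E)%E
    else (hausdorff_dim (@heis_dist R) E < 2%:E)%E].
Proof.
move=> lambda_gt0; have lambda_ge0 := ltW lambda_gt0.
have [|y [H [q [[fourqE heightE q_ge q_le H_large] q2]]]] :=
  @curve_parameters R (22 * (2 * lambda + 1) + 4) above.
  lra.
pose g := curve y H.
have g_ref : refinable y H 10 g by exact: (curve_refinable fourqE heightE q_ge q_le).
have q0 := q_gt0 q_ge; have q1 := q_lt1 q_le.
have g0 := refinable0 fourqE q_le g_ref.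
have g1 := refinable1 fourqE heightE q_le g_ref.
have [C C0 g_upper] := increment_upper fourqE heightE q_ge g_ref.
exists (arc g); split.
- exact: arc_connected g0 g_upper.
- apply: arc_vertical.
  exact: (increment_vertical fourqE heightE q_ge q_le lambda_ge0 H_large g_ref).
- exists (g 0), (g 1); split.
  + by exists 0 => //=; rewrite in_itv/= lexx ler01.
  + by exists 1 => //=; rewrite in_itv/= lexx ler01.
  + by rewrite g0 g1 => -[] /eqP; rewrite eq_sym oner_eq0.
- case: above q2 => q2.
    apply: arc_dim_gt2 q2 => // k s t s0 t1 st.
    by have [] := increment_lower fourqE heightE q_ge q_le lambda_ge0 H_large g_ref s0 t1 st.
  exact: arc_dim_lt2 g_upper q2.
Qed.

Unset Implicit Arguments.

Theorem theorem1p4 (R : realType) (lambda : R) (lambda_gt0 : 0 < lambda) :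
  exists E E' : set (heis R),
    [/\ connected E, vertical_curve lambda E &
        exists p q : heis R, [/\ E p, E q & p <> q]] /\
    [/\ connected E' & vertical_curve lambda E'] /\
    (hausdorff_dim (@heis_dist R) E < 2%:E)%E /\
    (2%:E < hausdorff_dim (@heis_dist R) E')%E.
Proof.
have [E [E_connected E_vertical E_points E_dim]] := arc_exists false lambda_gt0.
have [E' [E'_connected E'_vertical _ E'_dim]] := arc_exists true lambda_gt0.
by exists E, E'.
Qed.
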